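(* Let $pod_2(n)$ be defined by $\sum_{n\ge 0} pod_2(n)q^n = \frac{\psi(-q^2)}{\psi(-q)} = \frac{f_2^2 f_8}{f_1 f_4^2}$. Let $p$ be a prime with $p\equiv 7\pmod 8$, and let $r$ be an integer with $1\le r<8p$, $r\equiv 7 \pmod 8$ and $\gcd(r,p)=1$. Then for all $n\ge 0$ and $k\ge 0$, $$pod_2\!\left(p^{2k+2}n + \frac{rp^{2k+1}-1}{8}\right)\equiv 0 \pmod 8.$$
   Context: For $|q|<1$ and integers $j\ge 1$, $f_j := \prod_{n=1}^{\infty}(1-q^{jn})$. Ramanujan's theta function is $\psi(q) := \sum_{n=0}^{\infty} q^{n(n+1)/2} = f_2^2/f_1$, so that $\psi(-q) = f_1f_4/f_2$. The paper describes $pod_2(n)$ as the number of $2$-regular partitions of $n$ with distinct odd parts (even parts unrestricted), with generating function $\sum_{n\ge0} pod_2(n)q^n = \psi(-q^2)/\psi(-q)$. *)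

(* Defs.v *)
From mathcomp Require Import all_boot all_order all_algebra.

Set Implicit Arguments.
Unset Strict Implicit.
Unset Printing Implicit Defensive.

Import GRing.Theory.
Local Open Scope ring_scope.

(* The q-series are formal power series with integer coefficients:            *)
(* F : fps stands for \sum_n F n q^n.                                         *)
Definition fps := nat -> int.

Definition fps_mul (F G : fps) : fps :=
  fun n => \sum_(i < n.+1) F i * G (n - i)%N.

(* F(c q^d); meaningful for 0 < d. *)
Definition fps_subst (c : int) (d : nat) (F : fps) : fps :=
  fun n => if (d %| n)%N then c ^+ (n %/ d) * F (n %/ d)%N else 0.

(* The first n coefficients of F / G when G has constant term 1, from         *)
(* F n = \sum_(i <= n) H i * G (n - i) solved for H n.                        *)
Fixpoint fps_div_seq (F G : fps) (n : nat) : seq int :=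
  if n is m.+1 then
    let s := fps_div_seq F G m in
    rcons s (F m - \sum_(i < m) s`_i * G (m - i)%N)
  else [::].

Definition fps_div (F G : fps) : fps := fun n => (fps_div_seq F G n.+1)`_n.

(* psi(q) = \sum_(m >= 0) q^(m(m+1)/2). Only m <= n can contribute to the     *)
(* coefficient of q^n, since m <= m(m+1)/2.                                   *)
Definition psi : fps :=
  fun n => \sum_(m < n.+1) ((m * m.+1) %/ 2 == n)%N%:R.

Definition pod2 : fps :=
  fps_div (fps_subst (-1) 2 psi) (fps_subst (-1) 1 psi).

Lemma size_fps_div_seq F G n : size (fps_div_seq F G n) = n.
Proof. by elim: n => //= n IHn; rewrite size_rcons IHn. Qed.

Lemma nth_fps_div_seq F G n i :
  (i < n)%N -> (fps_div_seq F G n)`_i = fps_div F G i.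
Proof.
elim: n => // n IHn; rewrite ltnS leq_eqVlt => /predU1P[-> //|lt_in].
by rewrite /= nth_rcons size_fps_div_seq lt_in IHn.
Qed.

Lemma fps_divK F G : G 0%N = 1 -> fps_mul (fps_div F G) G =1 F.
Proof.
move=> G0 n; rewrite /fps_mul big_ord_recr /= subnn G0 mulr1.
rewrite {2}/fps_div /= nth_rcons size_fps_div_seq ltnn eqxx.
under [X in _ + (_ - X)]eq_bigr => i _ do rewrite nth_fps_div_seq //.
by rewrite addrC subrK.
Qed.

Lemma fps_mulIr F F' G :
  G 0%N = 1 -> fps_mul F G =1 fps_mul F' G -> F =1 F'.
Proof.
move=> G0 eqFG n; elim/ltn_ind: n => n IHn; have := eqFG n.
rewrite /fps_mul !big_ord_recr /= subnn G0 !mulr1.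
by under eq_bigr => i _ do rewrite IHn //; move/addrI.
Qed.

(* The defining equation pod2(q) psi(-q) = psi(-q^2); by fps_mulIr it         *)
(* determines pod2.                                                           *)
Lemma pod2_gf :
  fps_mul pod2 (fps_subst (-1) 1 psi) =1 fps_subst (-1) 2 psi.
Proof.
by apply: fps_divK; rewrite /fps_subst /psi /= big_ord1 /= expr0 mul1r.
Qed.

(* Main.v *)
Require Import Defs.
From HB Require Import structures.
From mathcomp Require Import all_boot all_order all_algebra.
From mathcomp Require Import zify ring.
From mathcomp Require Import boolp classical_sets functions cardinality fsbigop.

(** The product [psi(q) psi(-q)], written as a double sum over pairs of integers
[(i, j)] with sign [(-1)^j] and exponent [i (2 i + 1) + j (2 j + 1)], loses the terms
with [i - j] odd to the exchange of [i] and [j]; the substitution [i = s + t],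
[j = s - t] turns the others into [psi(-q^2) phi(-q^4)]. Hence
[sum pod2(n) q^n = psi(q) / phi(-q^4)], and with [phi(-q^4) = 1 + 2 T],
[T = sum_(t >= 1) (-1)^t q^(4 t^2)], this is [psi - 2 psi T + 4 psi T^2] modulo [8].
Modulo [2] only the diagonal of [T^2] survives, so [pod2(N)] can be nonzero modulo
[8] only if [8 N + 1] has the form [x^2 + 32 a^2] or [x^2 + 64 a^2]. For
[p = 7] modulo [8], neither [-2] nor [-1] is a square modulo [p], so numbers of these
forms are divisible by [p] to an even power, whereas [8 N + 1 = p^(2 k + 1) m] with [m]
prime to [p]. *)

Set Implicit Arguments.
Unset Strict Implicit.
Unset Printing Implicit Defensive.

Import Order.TTheory GRing.Theory.
Local Open Scope classical_set_scope.
Local Open Scope ring_scope.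

(** * The ring of formal power series *)

Lemma fps_mul_coefM (F G : fps) (P Q : {poly int}) n :
    (forall i, (i <= n)%N -> P`_i = F i) ->
    (forall i, (i <= n)%N -> Q`_i = G i) ->
  fps_mul F G n = (P * Q)`_n.
Proof.
move=> eqF eqG; rewrite coefM; apply: eq_bigr => i _.
by rewrite eqF ?eqG ?leq_subr // -ltnS.
Qed.

Definition fps_trunc n (F : fps) : {poly int} := \poly_(i < n.+1) F i.

Lemma coef_fps_trunc n F i : (i <= n)%N -> (fps_trunc n F)`_i = F i.
Proof. by rewrite coef_poly ltnS => ->. Qed.

Lemma fps_mulA : associative fps_mul.
Proof.
move=> F G H; apply/funext => n; pose P := fps_trunc n.
have mulP F1 F2 i : (i <= n)%N -> (P F1 * P F2)`_i = fps_mul F1 F2 i.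
  move=> le_in; apply/esym/fps_mul_coefM => j le_ji;
    exact: coef_fps_trunc (leq_trans le_ji le_in).
rewrite (@fps_mul_coefM _ _ (P F) (P G * P H)) ?mulrA //; last first.
- by move=> i; apply: mulP.
- by move=> i; apply: coef_fps_trunc.
by apply/esym/fps_mul_coefM => i; [apply: mulP | apply: coef_fps_trunc].
Qed.

Lemma fps_mulC : commutative fps_mul.
Proof.
move=> F G; apply/funext => n.
by rewrite !(fps_mul_coefM (@coef_fps_trunc n _) (@coef_fps_trunc n _)) mulrC.
Qed.

Definition fps_one : fps := fun n => (n == 0)%N%:R.

Lemma fps_mul1 : left_id fps_one fps_mul.
Proof.
move=> F; apply/funext => n; rewrite /fps_mul big_ord_recl subn0 mul1r.
by rewrite big1 ?addr0 // => i _; rewrite mul0r.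
Qed.

(* Only the additive structure is the pointwise one of [nat -> int]. *)
HB.instance Definition _ := GRing.Zmodule.copy fps (nat -> int).

Lemma fps_mulDl : left_distributive fps_mul +%R.
Proof.
move=> F G H; apply/funext => n; rewrite !addrfctE /fps_mul /= -big_split.
by apply: eq_bigr => i _; rewrite mulrDl.
Qed.

Lemma fps_one_neq0 : fps_one != 0.
Proof. by apply/eqP => /(congr1 (fun F : fps => F 0%N)). Qed.

HB.instance Definition _ := GRing.Zmodule_isComNzRing.Build fps
  fps_mulA fps_mulC fps_mul1 fps_mulDl fps_one_neq0.

Lemma coef_fpsM (F G : fps) n : (F * G) n = \sum_(i < n.+1) F i * G (n - i)%N.
Proof. by []. Qed.

Lemma fps_rreg (G : fps) : G 0%N = 1 -> GRing.rreg G.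
Proof.
move=> G0 F F' eqFG; apply/funext/(fps_mulIr G0) => n.
by have /(congr1 (fun H : fps => H n)) := eqFG.
Qed.

Lemma dvdz_coef_fpsM (d : int) (F G : fps) n :
    (forall i j, (i + j)%N = n -> F i != 0 -> (d %| G j)%Z) ->
  (d %| (F * G) n)%Z.
Proof.
move=> d_dvd; rewrite coef_fpsM; apply: rpred_sum => i _.
have [->|Fi] := eqVneq (F i) 0; first by rewrite mul0r dvdz0.
by rewrite dvdz_mull // (d_dvd i) // subnKC // -ltnS.
Qed.

Lemma dvd2_coef_fps_sqr (F : fps) n :
  (forall m, (m + m)%N = n -> (2 %| F m)%Z) -> (2 %| (F ^+ 2) n)%Z.
Proof.
move=> dvd2F; rewrite expr2 coef_fpsM.
pose T (i : 'I_n.+1) : int := F i * F (n - i)%N.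
have upper_eq_lower :
    \sum_(i < n.+1 | (n < i + i)%N) T i = \sum_(i < n.+1 | (i + i < n)%N) T i.
  rewrite (reindex_inj rev_ord_inj); apply: eq_big => i.
    by have := ltn_ord i; rewrite /=; lia.
  by rewrite /T /= subSS subKn 1?mulrC // -ltnS.
rewrite (bigID (fun i : 'I_n.+1 => (i + i < n)%N)) /=.
rewrite [X in _ + X](bigID (fun i : 'I_n.+1 => (n < i + i)%N)) /=.
rewrite [X in _ + (X + _)](eq_bigl (fun i : 'I_n.+1 => (n < i + i)%N)); last first.
  by move=> i; lia.
rewrite upper_eq_lower addrA rpredD //.
  by apply/dvdzP; eexists; rewrite -[LHS]mulr2n -[LHS]mulr_natr.
by apply: rpred_sum => i mid_i; rewrite dvdz_mulr // dvd2F //; lia.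
Qed.

(** * Generating functions of weighted sets *)

Lemma mem_fiber (I : Type) (e : I -> nat) n i :
  (i \in e @^-1` [set n]) = (e i == n).
Proof. by apply/idP/eqP; rewrite inE. Qed.

Lemma fsbig_partition_ord (R : Type) (idx : R) (op : Monoid.com_law idx)
    (I : choiceType) m (g : I -> nat) (A : set I) (F : I -> R) :
    finite_set A -> (forall x, A x -> (g x < m)%N) ->
  \big[op/idx]_(x \in A) F x
    = \big[op/idx]_(i < m) \big[op/idx]_(x \in A `&` g @^-1` [set val i]) F x.
Proof.
move=> A_fin ltg; under [RHS]eq_bigr do rewrite fsbig_mkcondr fsbig_finite //.
rewrite exchange_big fsbig_finite //; apply: eq_big_seq => x.
rewrite in_fset_set // inE => Ax; rewrite -big_mkcond.
by rewrite (big_pred1 (Ordinal (ltg x Ax))) // => i; rewrite mem_fiber eq_sym.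
Qed.

Definition finite_fibers (I : Type) (e : I -> nat) : Prop :=
  forall n, finite_set (e @^-1` [set n]).

Lemma finite_fibers_le (I : Type) (e f : I -> nat) :
  (forall i, e i <= f i)%N -> finite_fibers e -> finite_fibers f.
Proof.
move=> le_ef e_fin n.
apply: sub_finite_set (bigcup_finite (finite_II n.+1) (fun m _ => e_fin m)).
by move=> i /= <-; exists (e i); rewrite //= ltnS.
Qed.

Lemma finite_fibers_absz : finite_fibers absz.
Proof.
move=> n; apply: (@sub_finite_set _ _ [set Posz n; - Posz n]) => [i /= <-|].
  by case: i => m; [left | right].
exact: finite_set2.
Qed.

Lemma finite_fibersD (I J : choiceType) (e : I -> nat) (f : J -> nat) :
    finite_fibers e -> finite_fibers f ->
  finite_fibers (fun x : I * J => e x.1 + f x.2)%N.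
Proof.
move=> e_fin f_fin n.
pose fibers i := (e @^-1` [set i]) `*` (f @^-1` [set (n - i)%N]).
apply: (@sub_finite_set _ _ (\bigcup_(i in `I_n.+1) fibers i)) => [[a b] /= eq_n|].
  by exists (e a); [rewrite /=; lia | split=> //=; lia].
by apply: bigcup_finite => // i _; apply: finite_setX.
Qed.

(* The series \sum_(i in A) w i q^(e i), provided that [e] has finite fibers on [A]:
   a sum over a set on which [w] has infinite support is 0. *)
Definition genfun (I : choiceType) (w : I -> int) (e : I -> nat) (A : set I) : fps :=
  fun n => \sum_(i \in A `&` e @^-1` [set n]) w i.

Section GeneratingFunctions.

Variable I : choiceType.
Implicit Types (w : I -> int) (e : I -> nat) (A B : set I).

Lemma eq_genfun w w' e e' A :
  {in A, w =1 w'} -> {in A, e =1 e'} -> genfun w e A = genfun w' e' A.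
Proof.
move=> eq_w eq_e; apply/funext => n; rewrite /genfun.
have -> : A `&` e @^-1` [set n] = A `&` e' @^-1` [set n].
  by apply/seteqP; split=> i /= [Ai <-]; rewrite eq_e // inE.
by apply: eq_fsbigr => i; rewrite inE => -[Ai _]; rewrite eq_w // inE.
Qed.

Lemma genfun_neq0 w e A n : genfun w e A n != 0 -> exists2 i, A i & e i = n.
Proof.
apply: contraNP => no_i; apply/eqP/fsbig1 => i [Ai eq_n].
by case: no_i; exists i.
Qed.

Lemma genfun_set1 w e i : genfun w e [set i] = fun n => if e i == n then w i else 0.
Proof.
by apply/funext => n; rewrite /genfun fsbig_mkcondr fsbig_set1 mem_fiber.
Qed.

Lemma genfunU w e A B : finite_fibers e -> A `&` B = set0 ->
  genfun w e (A `|` B) = genfun w e A + genfun w e B.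
Proof.
move=> e_fin AB0; apply/funext => n; rewrite addrfctE /genfun setIUl.
apply: fsbigU0 => [||i [[Ai _] [Bi _]]]; [exact: finite_setIr..|].
by rewrite -AB0.
Qed.

Lemma genfunN w e A : genfun (fun i => - w i) e A = - genfun w e A.
Proof.
apply/funext => n; rewrite opprfctE /genfun -mulN1r mulr_fsumr.
by apply: eq_fsbigr => i _; rewrite mulN1r.
Qed.

Lemma fps_subst_genfun (c : int) d w e A : (0 < d)%N ->
  fps_subst c d (genfun w e A)
    = genfun (fun i => c ^+ e i * w i) (fun i => d * e i)%N A.
Proof.
move=> d_gt0; apply/funext => n; rewrite /fps_subst /genfun.
case: ifP => [/dvdnP[m ->] | ndvd].
  rewrite mulnK // mulr_fsumr.
  have -> : (fun i => d * e i)%N @^-1` [set (m * d)%N] = e @^-1` [set m].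
    apply/seteqP; split=> i /= eq_m; last by rewrite eq_m mulnC.
    by apply/eqP; rewrite -(eqn_pmul2l d_gt0) eq_m mulnC.
  by apply: eq_fsbigr => i; rewrite inE => -[_ /= ->].
rewrite fsbig1 // => i [_ /= eq_n].
by rewrite -eq_n dvdn_mulr in ndvd.
Qed.

Lemma genfun_reindex (J : choiceType) (h : J -> I) w e A (B : set J) :
  set_bij B A h -> genfun w e A = genfun (w \o h) (e \o h) B.
Proof.
move=> [hBA h_inj h_surj]; apply/funext => n; rewrite /genfun.
apply: reindex_fsbig; split=> [j [Bj eq_n] | j k jB kB | i [Ai eq_n]].
- by split; [exact: hBA|].
- by apply: h_inj; rewrite inE; [case: (set_mem jB) | case: (set_mem kB)].
by have [j Bj eq_i] := h_surj i Ai; exists j; rewrite //= eq_i.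
Qed.

Lemma genfun_sign_reversing (s : I -> I) w e A :
    set_bij A A s -> {in A, forall i, e (s i) = e i} ->
    {in A, forall i, w (s i) = - w i} ->
  genfun w e A = 0.
Proof.
move=> s_bij es ws; have eq_opp : genfun w e A = - genfun w e A.
  by rewrite -genfunN {1}(genfun_reindex _ _ s_bij); apply: eq_genfun.
apply/funext => n; rewrite -[RHS]/(0 : int).
by have := congr1 (fun F : fps => F n) eq_opp; rewrite opprfctE; lia.
Qed.

End GeneratingFunctions.

Lemma genfunM (I J : choiceType) (w : I -> int) (v : J -> int) (e : I -> nat)
    (f : J -> nat) (A : set I) (B : set J) :
    finite_fibers e -> finite_fibers f ->
  genfun w e A * genfun v f B =
  genfun (fun x => w x.1 * v x.2) (fun x => e x.1 + f x.2)%N (A `*` B).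
Proof.
move=> e_fin f_fin; apply/funext => n.
rewrite [RHS](@fsbig_partition_ord _ _ _ _ n.+1 (fun x => e x.1)); first last.
- by move=> x [_ /= <-]; rewrite ltnS leq_addr.
- exact/finite_setIr/finite_fibersD.
apply: eq_bigr => i _; have le_in : (i <= n)%N by rewrite -ltnS.
rewrite mulr_fsuml; under [LHS]eq_fsbigr do rewrite mulr_fsumr.
rewrite pair_fsbig; [|exact: finite_setIr..].
apply: eq_fsbigl; apply/seteqP; split=> -[a b] /=.
  by move=> [[Aa ea] [Bb fb]]; split=> //; split=> //; rewrite ea fb subnKC.
by move=> [[[Aa Bb] eq_n] ea]; split=> //; split=> //; lia.
Qed.

(** * Theta functions *)

Definition zsign (i : int) : int := (-1) ^+ `|i|%N.

Lemma eq_signr_odd m n : odd m = odd n -> (-1) ^+ m = (-1) ^+ n :> int.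
Proof. by move=> eq_mn; rewrite -signr_odd eq_mn signr_odd. Qed.

(* As [i] ranges over the integers, [i (2 i + 1)] runs once through the triangular
   numbers. *)
Definition hexagonal (i : int) : nat := absz (i * (2 * i + 1)).

Lemma hexagonalE i : Posz (hexagonal i) = i * (2 * i + 1).
Proof. by rewrite /hexagonal gez0_abs //; nia. Qed.

Lemma odd_hexagonal i : odd (hexagonal i) = odd `|i|.
Proof. by rewrite /hexagonal abszM oddM; lia. Qed.

Lemma mul8_hexagonalD1 i : (8 * hexagonal i + 1 = absz (4 * i + 1)%R ^ 2)%N.
Proof. by have := hexagonalE i; rewrite -mulnn; nia. Qed.

Lemma finite_fibers_hexagonal : finite_fibers hexagonal.
Proof.
apply: finite_fibers_le finite_fibers_absz => i.
by rewrite /hexagonal abszM leq_pmulr //; lia.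
Qed.

Lemma psi_genfun_triangular :
  psi = genfun (fun=> 1) (fun m => m * m.+1 %/ 2)%N [set: nat].
Proof.
apply/funext => n; rewrite /psi /genfun setTI.
set e := fun m => (m * m.+1 %/ 2)%N.
have fiber_le : e @^-1` [set n] `<=` `I_n.+1.
  move=> m /= <-; rewrite ltnS leq_divRL //.
  by case: m => [|m] //; rewrite leq_mul2l.
rewrite -(setIidr fiber_le) fsbig_mkcondr.
rewrite (fsbig_ord _ n.+1 (fun m => (e m == n)%N%:R)); apply: eq_fsbigr => m _.
by rewrite mem_fiber; case: eqP.
Qed.

Lemma psi_genfun : psi = genfun (fun=> 1) hexagonal [set: int].
Proof.
pose h (i : int) := if 0 <= i then absz (2 * i) else absz (2 * i + 1).
pose g m := if odd m then - Posz (m.+1)./2 else Posz m./2.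
have h_bij : set_bij [set: int] [set: nat] h.
  by rewrite setTT_bijective; exists g => x; rewrite /h /g; do 2!case: ifP; lia.
rewrite psi_genfun_triangular (genfun_reindex _ _ h_bij).
apply: eq_genfun => // i _ /=; have eq_h : (h i * (h i).+1 = hexagonal i * 2)%N.
  by have := hexagonalE i; rewrite /h; case: leP; nia.
by rewrite eq_h mulnK.
Qed.

Lemma psi_neq0 n : psi n != 0 -> exists x, (8 * n + 1 = x ^ 2)%N.
Proof.
rewrite psi_genfun => /genfun_neq0[i _ <-].
by exists (absz (4 * i + 1)); apply: mul8_hexagonalD1.
Qed.

Lemma psi_subst_neg d : (0 < d)%N ->
  fps_subst (-1) d psi = genfun zsign (fun i => d * hexagonal i)%N [set: int].
Proof.
move=> d_gt0; rewrite psi_genfun fps_subst_genfun //; apply: eq_genfun => // i _.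
by rewrite mulr1; apply/eq_signr_odd/odd_hexagonal.
Qed.

Definition four_sqr (t : int) : nat := 4 * `|t| ^ 2.

Lemma finite_fibers_four_sqr : finite_fibers four_sqr.
Proof.
by apply: finite_fibers_le finite_fibers_absz => t; rewrite /four_sqr; nia.
Qed.

(* phi(-q^4) and (phi(-q^4) - 1) / 2, where phi(q) = \sum_(t in Z) q^(t^2). *)
Definition phi_neg4 : fps := genfun zsign four_sqr [set: int].

Definition half_phi_neg4 : fps := genfun zsign four_sqr [set t | 0 < t].

Lemma phi_neg4E : phi_neg4 = 1 + half_phi_neg4 *+ 2.
Proof.
have -> : phi_neg4 = genfun zsign four_sqr
    ([set 0] `|` ([set t | 0 < t] `|` [set t | t < 0])).
  congr genfun; apply/seteqP; split=> // t _ /=.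
  by have [||->] := ltgtP t 0; auto.
have fin := finite_fibers_four_sqr.
rewrite !genfunU //; last 2 first.
- by apply/seteqP; split=> t //= [? ?]; lia.
- by apply/seteqP; split=> t //= [->] [|]; lia.
have -> : genfun zsign four_sqr [set t | t < 0] = half_phi_neg4.
  have opp_bij : set_bij [set t : int | 0 < t] [set t | t < 0] -%R.
    split=> [t|t u _ _|t] /=; [lia | exact: oppr_inj |].
    by move=> t_lt0; exists (- t); lia.
  rewrite (genfun_reindex _ _ opp_bij).
  by apply: eq_genfun => t _; rewrite /= /zsign /four_sqr abszN.
by congr (_ + _); apply/funext => -[|n]; rewrite genfun_set1.
Qed.

Lemma half_phi_neg4_neq0 n : half_phi_neg4 n != 0 -> exists a, n = (4 * a ^ 2)%N.
Proof. by move/genfun_neq0 => [t _ <-]; exists `|t|%N. Qed.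

Definition odd_diff : set (int * int) := [set x | odd (absz (x.1 - x.2))].

Definition even_diff : set (int * int) := [set x | ~~ odd (absz (x.1 - x.2))].

Lemma odd_diffU_even_diff : odd_diff `|` even_diff = [set: int * int].
Proof.
by apply/seteqP; split=> // x _; rewrite /odd_diff /even_diff /=; case: odd; auto.
Qed.

Lemma swap_odd_diff_bij : set_bij odd_diff odd_diff (fun x => (x.2, x.1)).
Proof.
split=> [[i j]|[i j] [i' j'] _ _ [-> ->]|[i j]] //; rewrite /odd_diff /=.
  by lia.
by exists (j, i) => //=; lia.
Qed.

Lemma add_sub_even_diff_bij :
  set_bij [set: int * int] even_diff (fun x => (x.1 + x.2, x.1 - x.2)).
Proof.
split=> [x _ | [s t] [s' t'] _ _ [eq_add eq_sub] | [i j]]; rewrite /even_diff /=.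
- by lia.
- by congr (_, _); lia.
move=> ij_even; exists ((i + j) %/ 2, (i - j) %/ 2)%Z => //.
by congr (_, _) => /=; lia.
Qed.

Lemma psi_mul_psi_neg :
  psi * fps_subst (-1) 1 psi = fps_subst (-1) 2 psi * phi_neg4.
Proof.
have fin := finite_fibers_hexagonal.
have fin_mul d : (0 < d)%N -> finite_fibers (fun i => d * hexagonal i)%N.
  by move=> d_gt0; apply: finite_fibers_le fin => i; rewrite leq_pmull.
rewrite !psi_subst_neg // {1}psi_genfun !genfunM ?setXTT //; first last.
- exact: fin_mul.
- exact: finite_fibers_four_sqr.
- exact: fin_mul.
rewrite -[in LHS]odd_diffU_even_diff genfunU; last 2 first.
- exact: finite_fibersD fin (fin_mul _ _).
- by apply/seteqP; split=> x //= [? /negP].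
rewrite (genfun_sign_reversing swap_odd_diff_bij) ?add0r; last 2 first.
- by move=> [i j] _ /=; rewrite !mul1n addnC.
- move=> [i j] /set_mem; rewrite /odd_diff /= => ij_odd.
  by rewrite !mul1r -[RHS]mulN1r -exprS; apply: eq_signr_odd; lia.
rewrite (genfun_reindex _ _ add_sub_even_diff_bij).
apply: eq_genfun => -[s t] _ /=.
  by rewrite mul1r -exprD; apply: eq_signr_odd; lia.
have := hexagonalE s; have := hexagonalE (s + t); have := hexagonalE (s - t).
by rewrite /four_sqr; nia.
Qed.

Lemma pod2_mul_phi_neg4 : pod2 * phi_neg4 = psi.
Proof.
apply: (@fps_rreg (fps_subst (-1) 1 psi)).
  by rewrite /fps_subst /psi /= big_ord1 /= expr0 mul1r.
by rewrite psi_mul_psi_neg mulrAC -(funext pod2_gf).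
Qed.

Lemma pod2_expansion :
  pod2 = psi - (psi * half_phi_neg4) *+ 2 + (psi * half_phi_neg4 ^+ 2) *+ 4
    - (pod2 * half_phi_neg4 ^+ 3) *+ 8.
Proof. by rewrite -{1 2 3}pod2_mul_phi_neg4 phi_neg4E; ring. Qed.

Lemma dvd8_pod2_unrepresented N :
    (forall x a, (x ^ 2 + 32 * a ^ 2)%N <> (8 * N + 1)%N) ->
    (forall x a, (x ^ 2 + 64 * a ^ 2)%N <> (8 * N + 1)%N) ->
  (8 %| pod2 N)%Z.
Proof.
move=> no_rep32 no_rep64; set T := half_phi_neg4.
have psi_N : psi N = 0.
  apply/eqP/negPn/negP => /psi_neq0[x eq_x]; apply: (no_rep64 x 0%N).
  by rewrite eq_x addn0.
have dvd4_psiT : (4 %| (psi * T) N)%Z.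
  apply: dvdz_coef_fpsM => i j eq_N /psi_neq0[x eq_x].
  have [->|/half_phi_neg4_neq0[a eq_a]] := eqVneq (T j) 0; first exact: dvdz0.
  by case: (no_rep32 x a); lia.
have dvd2_psiT2 : (2 %| (psi * T ^+ 2) N)%Z.
  apply: dvdz_coef_fpsM => i j eq_N /psi_neq0[x eq_x].
  apply: dvd2_coef_fps_sqr => m eq_j.
  have [->|/half_phi_neg4_neq0[a eq_a]] := eqVneq (T m) 0; first exact: dvdz0.
  by case: (no_rep64 x a); lia.
rewrite pod2_expansion !(addrfctE, opprfctE, natmulfctE) psi_N -/T.
have /dvdzP[u ->] := dvd4_psiT; have /dvdzP[v ->] := dvd2_psiT2.
by apply/dvdzP; exists (v - u - (pod2 * T ^+ 3) N); ring.
Qed.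

Local Close Scope ring_scope.

(** * The forms x^2 + d y^2 *)

Lemma dvdn_sqrD_parity (e : bool) n a d :
    odd n -> ~~ (n %| d) -> n %| a ^ 2 + d ->
  exists b, [/\ odd b = e, b < n & n %| b ^ 2 + d].
Proof.
move=> n_odd n_ndvd n_dvd; pose b := a %% n.
have lt_bn : b < n by rewrite ltn_mod; case: (n) n_odd.
have b_dvd : n %| b ^ 2 + d by rewrite /dvdn -modnDml modnXm modnDml.
have [eq_b|neq_b] := eqVneq (odd b) e; first by exists b.
have b_gt0 : 0 < b.
  by rewrite lt0n; apply: contraNneq n_ndvd => b0; rewrite b0 in b_dvd.
exists (n - b); rewrite (oddB (ltnW lt_bn)) n_odd; split.
- by case: (odd b) e neq_b => -[].
- by rewrite ltn_subrL b_gt0 (leq_trans _ lt_bn).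
rewrite -(dvdn_addl _ (dvdn_mulr b (dvdn_mull 2 (dvdnn n)))).
have -> : (n - b) ^ 2 + d + 2 * n * b = n * n + (b ^ 2 + d).
  by rewrite -{2 3 4}(subnK (ltnW lt_bn)); ring.
by rewrite (dvdn_addr _ (dvdn_mulr n (dvdnn n))).
Qed.

(* Fermat descent: replacing [a] by [b < n] of the parity [e] gives [n] a cofactor in
   [b ^ 2 + d] that is smaller than [n] and again satisfies [S]. *)
Lemma ndvdn_sqrD_descent (S : pred nat) (e : bool) d n a :
    0 < d -> (forall m, S m -> odd m && (d < m)) ->
    (forall m b c, S m -> odd b = e -> b ^ 2 + d = c * m -> S c) ->
  S n -> ~~ (n %| a ^ 2 + d).
Proof.
move=> d_gt0 S_odd S_cofactor; elim/ltn_ind: n a => n IHn a Sn.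
apply/negP => n_dvd; have /andP[n_odd lt_dn] := S_odd n Sn.
have [|b [b_parity lt_bn /dvdnP[c eq_c]]] := dvdn_sqrD_parity e n_odd _ n_dvd.
  by rewrite gtnNdvd.
have Sc := S_cofactor n b c Sn b_parity eq_c.
have lt_cn : c < n by rewrite -mulnn in eq_c; nia.
by have /negP[] := IHn c lt_cn b Sc; rewrite eq_c dvdn_mulr.
Qed.

Lemma ndvdn_sqrD1 n a : n %% 4 = 3 -> ~~ (n %| a ^ 2 + 1).
Proof.
move/eqP; apply: (@ndvdn_sqrD_descent (fun m => m %% 4 == 3) false) => //.
  by move=> m; lia.
move=> m b c /eqP m_mod b_even; have -> : b = 2 * b./2 by lia.
by rewrite -mulnn => eq_c; apply/eqP; nia.
Qed.

Lemma sqr_odd_mod8 b : odd b -> b ^ 2 = 1 %[mod 8].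
Proof.
move=> b_odd; rewrite -modnXm; have : odd (b %% 8) by lia.
have : b %% 8 < 8 by rewrite ltn_mod.
by move: (b %% 8); do 8!case=> //.
Qed.

Lemma ndvdn_sqrD2 n a : n %% 8 \in [:: 5; 7] -> ~~ (n %| a ^ 2 + 2).
Proof.
apply: (@ndvdn_sqrD_descent (fun m => m %% 8 \in [:: 5; 7]) true) => // m.
  by rewrite !inE; lia.
move=> b c m_mod /sqr_odd_mod8 b_sqr eq_c.
have cm_mod : (c %% 8) * (m %% 8) = 3 %[mod 8] by rewrite modnMm -eq_c; lia.
have : c %% 8 < 8 by rewrite ltn_mod.
move: m_mod cm_mod; rewrite !inE => /orP[]/eqP->;
  by move: (c %% 8); do 8!case=> //.
Qed.

Lemma prime_dvdn_sqrDM p d x y : prime p -> (forall a, ~~ (p %| a ^ 2 + d)) ->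
  p %| x ^ 2 + d * y ^ 2 -> (p %| x) && (p %| y).
Proof.
move=> p_prime p_ndvd; have dvdp := dvdn_pcharf (pchar_Fp p_prime).
rewrite !dvdp natrD natrM !natrX => /eqP form0.
have [y0|y_neq0] := eqVneq (y%:R : 'F_p)%R 0%R.
  by move/eqP: form0; rewrite y0 expr0n mulr0 addr0 expf_eq0 /= andbT.
have /negP[] := p_ndvd (x%:R / y%:R : 'F_p)%R; rewrite dvdp natrD natrX natr_Zp.
by rewrite -(mulfK (expf_neq0 2 y_neq0) d%:R)%R expr_div_n -mulrDl form0 mul0r.
Qed.

Lemma even_logn_sqrDM p d x y : prime p -> (forall a, ~~ (p %| a ^ 2 + d)) ->
  ~~ odd (logn p (x ^ 2 + d * y ^ 2)).
Proof.
move=> p_prime p_ndvd; have [m] := ubnP (x ^ 2 + d * y ^ 2).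
elim: m => // m IHm in x y *; rewrite ltnS => le_m.
have [p_dvd|] := boolP (p %| x ^ 2 + d * y ^ 2); last first.
  by rewrite -prime_coprime // => /logn_coprime->.
have /andP[/dvdnP[u eq_x] /dvdnP[v eq_y]] := prime_dvdn_sqrDM p_prime p_ndvd p_dvd.
have eq_form : x ^ 2 + d * y ^ 2 = p ^ 2 * (u ^ 2 + d * v ^ 2).
  by rewrite eq_x eq_y; ring.
have [form0|form_gt0] := posnP (u ^ 2 + d * v ^ 2).
  by rewrite eq_form form0 muln0 logn0.
rewrite eq_form lognM ?expn_gt0 ?(prime_gt0 p_prime) // pfactorK // oddD /= IHm //.
apply: leq_trans le_m; rewrite eq_form ltn_Pmull //.
by rewrite -(expn0 p) ltn_exp2l ?prime_gt1.
Qed.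

Lemma dvd8_pod2 p N : prime p -> p %% 8 = 7 -> odd (logn p (8 * N + 1)) ->
  (8 %| pod2 N)%Z.
Proof.
move=> p_prime p_mod8 odd_logn; apply: dvd8_pod2_unrepresented => x a eq_N.
  have p_ndvd b : ~~ (p %| b ^ 2 + 2) by rewrite ndvdn_sqrD2 ?p_mod8.
  have /negP[] := even_logn_sqrDM x (2 ^ 2 * a) p_prime p_ndvd.
  by rewrite (_ : _ + _ = 8 * N + 1) // -eq_N; ring.
have p_ndvd b : ~~ (p %| b ^ 2 + 1) by apply: ndvdn_sqrD1; lia.
have /negP[] := even_logn_sqrDM x (2 ^ 3 * a) p_prime p_ndvd.
by rewrite (_ : _ + _ = 8 * N + 1) // -eq_N; ring.
Qed.

Lemma expn_odd_mod8 p k : odd p -> p ^ (2 * k + 1) = p %[mod 8].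
Proof.
by move=> p_odd; rewrite expnD expnM -modnMml -modnXm sqr_odd_mod8 // exp1n mul1n.
Qed.

Lemma mul8_progressionD1 p r n k : r * p ^ (2 * k + 1) = 1 %[mod 8] ->
  8 * (p ^ (2 * k + 2) * n + (r * p ^ (2 * k + 1) - 1) %/ 8) + 1
    = p ^ (2 * k + 1) * (8 * p * n + r).
Proof.
move=> rp_mod8; have [d eq_d] : exists d, r * p ^ (2 * k + 1) = d * 8 + 1.
  by exists (r * p ^ (2 * k + 1) %/ 8); rewrite {1}(divn_eq (_ * _) 8) rp_mod8.
rewrite [RHS]mulnDr [X in _ = _ + X]mulnC eq_d addnK mulnK //.
by rewrite (addnS _ 1) expnS; ring.
Qed.

Theorem theorem1p4 (p r : nat) (p_prime : prime p) (p_mod8 : p = 7 %[mod 8])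
    (r_bounds : 1 <= r < 8 * p) (r_mod8 : r = 7 %[mod 8])
    (r_coprime : coprime r p) (n k : nat) :
  (pod2 (p ^ (2 * k + 2) * n + (r * p ^ (2 * k + 1) - 1) %/ 8)%N
     = 0 %[mod 8])%Z.
Proof.
apply/eqP; rewrite eqz_mod_dvd subr0; apply: (dvd8_pod2 p_prime p_mod8).
have p_odd : odd p by lia.
have rp_mod8 : r * p ^ (2 * k + 1) = 1 %[mod 8].
  by rewrite -modnMm r_mod8 expn_odd_mod8 // p_mod8.
have p_coprime : coprime p (8 * p * n + r).
  by rewrite mulnAC /coprime gcdnMDl gcdnC.
have cofactor_gt0 : 0 < 8 * p * n + r by lia.
rewrite mul8_progressionD1 // lognM ?expn_gt0 ?(prime_gt0 p_prime) //.
by rewrite pfactorK // (logn_coprime p_coprime) addn0; lia.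
Qed.
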